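(* Let $b=b_1\otimes\cdots\otimes b_L\in B_{\lambda_1}\otimes\cdots\otimes B_{\lambda_L}$ be an arbitrary (highest or not) path, let $\mathcal E_{l,j}$ be its local energies and let $N=\mathcal E_1(b)=\sum_{j=1}^L\mathcal E_{1,j}$. Consider the following procedure. (i) Draw a table with rows $l=1,2,\dots$ and columns $j=1,\dots,L$ containing the number $\mathcal E_{l,j}-\mathcal E_{l-1,j}\in\{0,1\}$ at position $(l,j)$ (the local energy distribution). (ii) Starting from the rightmost $1$ in the row $l=1$, pick one $1$ from each successive row, where the one picked in row $l+1$ must be weakly right of the one selected in row $l$. If there is no such $1$ in row $l+1$, stop; the position (row, column) of the lastly picked $1$ is called $(\mu_1,j_1)$. Change all the selected $1$'s into $0$. (iii) Repeat step (ii) $N-1$ more times to determine $(\mu_2,j_2),\dots,(\mu_N,j_N)$, thereby making all $1$'s into $0$. (iv) Put, for $k=1,\dots,N$ (with the original values $\mathcal E_{l,j}$), $$r_k=\sum_{i=1}^{j_k-1}\min(\mu_k,\lambda_i)+\mathcal E_{\mu_k,j_k}-2\sum_{i=1}^{j_k}\mathcal E_{\mu_k,i}.$$ Then the procedure (i)--(iv) is well defined, and $\bigl(\lambda,(\mu,r)\bigr)$, with $\lambda=(\lambda_1,\dots,\lambda_L)$ and $(\mu,r)=((\mu_k,r_k))_{k=1}^N$, coincides with the (unrestricted) rigged configuration $\phi(b)$. Moreover, consider the alternative procedure obtained by replacing (ii) with the following. (ii)$'$ Starting from any one of the lowest $1$'s (any $1$ in the row with largest $l$ among rows still containing a $1$),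 pick one $1$ from each preceding row, where the one picked in row $l-1$ must be the one nearest to, and weakly left of, the one selected in row $l$. The position of the firstly picked $1$ is called $(\mu_1,j_1)$. Change all the selected $1$'s into $0$. (In this alternative procedure, step (iii) repeats (ii)$'$ instead of (ii).) Then the procedure (i), (ii)$'$, (iii), (iv) is also well defined, and leads to the same rigged configuration up to a permutation of the $(\mu_k,j_k)$'s.
   Context: Crystals and combinatorial $R$. For $l\ge1$ let $B_l=\{x=(x_1,x_2)\in(\mathbb Z_{\ge0})^2: x_1+x_2=l\}$; $(x_1,x_2)$ is identified with a one-row semistandard tableau containing $x_1$ letters $1$ and $x_2$ letters $2$. Elements of $B_{\lambda_1}\otimes\cdots\otimes B_{\lambda_L}$ (formal tensor products, i.e. tuples) are called paths. For $x\in B_l$, $y\in B_k$ put $Q_0=\min(x_1,y_2)$, $Q_1=\min(x_2,y_1)$. The combinatorial $R$ is the bijection $B_l\otimes B_k\to B_k\otimes B_l$, $x\otimes y\mapsto \tilde y\otimes\tilde x$ (written $x\otimes y\simeq\tilde y\otimes\tilde x$), with $\tilde x=(x_1+Q_1-Q_0,\;x_2+Q_0-Q_1)$, $\tilde y=(y_1+Q_0-Q_1,\;y_2+Q_1-Q_0)$. The energy function is $H(x\otimes y)=Q_0=\min(x_1,y_2)$. Put $u_l=(l,0)\in B_l$. Local energy. For a path $b=b_1\otimes\cdots\otimes b_L$ and $l\ge1$ set $u_l^{(0)}=u_l$ and define $u_l^{(j)}\in B_l$ recursively by $u_l^{(j-1)}\otimes b_j\simeq b_j'\otimes u_l^{(j)}$.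 Then $\mathcal E_{l,j}:=H(u_l^{(j-1)}\otimes b_j)$ for $1\le j\le L$, and $\mathcal E_{0,j}:=0$. One always has $\mathcal E_{l,j}-\mathcal E_{l-1,j}\in\{0,1\}$. The KKR map $\phi$. Consider data $\mathrm{RC}=(\lambda,(\mu,r))$, where $\lambda$ is a finite sequence of positive integers (the quantum space, viewed as rows of boxes) and $(\mu,r)=((\mu_i,r_i))_i$ is a finite collection, regarded up to reordering, of pairs of a positive integer $\mu_i$ (a row length) and an integer $r_i$ (its rigging). The vacancy numbers are $p_j=\sum_k\min(j,\lambda_k)-2\sum_k\min(j,\mu_k)$. A row $\mu_i$ is singular if $r_i=p_{\mu_i}$. For a path $b=b_1\otimes\cdots\otimes b_L$, $\phi(b)$ is constructed as follows. Start from the empty configuration and process $b_1,b_2,\dots,b_L$ in this order. Within a factor $b_a=(x_1,x_2)$, process first its $x_2$ letters $2$, one at a time, and then its $x_1$ letters $1$, one at a time. The first letter processed in the factor creates a new row of length $1$ in the quantum space, and each further letter of the same factor adds one box to that row. When a letter $1$ is processed, $(\mu,r)$ is unchanged. When a letter $2$ is processed and $i$ letters of the same factor have already been processed, compute the vacancy numbers of the current configuration (before adding any box). If there is no singular row of $\mu$ of length $\ge i$, create a new row of length $1$ in $\mu$; otherwise choose arbitrarily one of the longest singular rows of $\mu$ among those of length $\ge i$, and add one box to it. Then, with the quantum space also enlarged, set the rigging of the newly created or lengthened row equal to its new vacancy number (so that it is singular in the new configuration), and keep all other riggings. The final result $\phi(b)=(\lambda,(\mu,r))$, with $\lambda=(\lambda_1,\dots,\lambda_L)$,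 is called the (unrestricted) rigged configuration of $b$; it is independent of the arbitrary choices. *)

(* Defs.v *)
From HB Require Import structures.
From mathcomp Require Import all_boot all_order all_algebra.

Set Implicit Arguments.
Unset Strict Implicit.
Unset Printing Implicit Defensive.

Local Open Scope nat_scope.

Definition elt := (nat * nat)%type.

Definition crystal (l : nat) : {pred elt} := [pred x : elt | x.1 + x.2 == l].

Definition u_elt (l : nat) : elt := (l, 0).

Definition Q0 (x y : elt) : nat := minn x.1 y.2.
Definition Q1 (x y : elt) : nat := minn x.2 y.1.

(* [combR x y] is the pair (y~, x~).  As Q0 <= x.1, y.2 and Q1 <= x.2, y.1, no
   subtraction below is truncated. *)
Definition combR (x y : elt) : elt * elt :=
  ((y.1 + Q0 x y - Q1 x y, y.2 + Q1 x y - Q0 x y),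
   (x.1 + Q1 x y - Q0 x y, x.2 + Q0 x y - Q1 x y)).

Definition energy (x y : elt) : nat := Q0 x y.

(* [carrier l s] is u_l^(j) when s consists of the first j factors of a path. *)
Definition carrier (l : nat) (s : seq elt) : elt :=
  foldl (fun v y => (combR v y).2) (u_elt l) s.

(* The factors of a path of length L, and the columns of the tables below, are
   indexed by 'I_L, i.e., from 0. *)
Definition local_energy L (b : L.-tuple elt) (l : nat) (j : 'I_L) : nat :=
  if l is 0 then 0 else energy (carrier l (take j b)) (tnth b j).

(* The quantum space, and the list of pairs (row length, rigging). *)
Definition config := (seq nat * seq (nat * int))%type.

Definition rc_equiv (rc rc' : config) : Prop :=
  rc.1 = rc'.1 /\ perm_eq rc.2 rc'.2.

Definition vacancy (nu mu : seq nat) (j : nat) : int :=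
  (\sum_(k <- nu) (minn j k)%:Z - 2 * \sum_(k <- mu) (minn j k)%:Z)%R.

Definition singular (rc : config) (row : nat * int) : bool :=
  row.2 == vacancy rc.1 (unzip1 rc.2) row.1.

(* i is the number of letters of the current factor already processed; if it is
   positive, the row of the current factor is the last one of nu. *)
Definition add_box (i : nat) (nu : seq nat) : seq nat :=
  if i is 0 then rcons nu 1 else incr_nth nu (size nu).-1.

(* The configuration with quantum space nu whose rows are those in rest and a
   singular row of length m. *)
Definition add_singular (nu : seq nat) (m : nat) (rest : seq (nat * int)) :
    config :=
  (nu, (m, vacancy nu (m :: unzip1 rest) m) :: rest).

Definition candidate (i : nat) (rc : config) (row : nat * int) : bool :=
  [&& row \in rc.2, singular rc row & i <= row.1].

(* [kkr_letter i rc a rc'] : processing the letter a, after i letters of the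
   same factor, may lead from rc to rc'. *)
Inductive kkr_letter (i : nat) (rc : config) : nat -> config -> Prop :=
| KkrOne : kkr_letter i rc 1 (add_box i rc.1, rc.2)
| KkrNew of (forall row, ~~ candidate i rc row) :
    kkr_letter i rc 2 (add_singular (add_box i rc.1) 1 rc.2)
| KkrGrow row of candidate i rc row
    & (forall row', candidate i rc row' -> row'.1 <= row.1) :
    kkr_letter i rc 2 (add_singular (add_box i rc.1) row.1.+1 (rem row rc.2)).

Fixpoint kkr_word (i : nat) (rc : config) (w : seq nat) (rc' : config) : Prop :=
  if w is a :: w' then
    exists rc1, kkr_letter i rc a rc1 /\ kkr_word i.+1 rc1 w' rc'
  else rc' = rc.

Definition letters (x : elt) : seq nat := nseq x.2 2 ++ nseq x.1 1.

Fixpoint kkr_path (rc : config) (b : seq elt) (rc' : config) : Prop :=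
  if b is x :: b' then
    exists rc1, kkr_word 0 rc (letters x) rc1 /\ kkr_path rc1 b' rc'
  else rc' = rc.

(* rc represents phi(b): up to the order of its rows, it is a result of the
   construction for some choice of the rows to be lengthened. *)
Definition is_phi (b : seq elt) (rc : config) : Prop :=
  exists rc0, kkr_path ([::], [::]) b rc0 /\ rc_equiv rc0 rc.

Definition table (L : nat) := nat -> 'I_L -> int.

Definition position (L : nat) := (nat * 'I_L)%type.

(* The first picked position, and the following ones in the order of picking. *)
Definition selection (L : nat) := (position L * seq (position L))%type.

(* The rows of the distribution are l = 1, 2, ...; row 0 is filled with 0's. *)
Definition distribution L (b : L.-tuple elt) : table L :=
  fun l j => ((local_energy b l j)%:Z - (local_energy b l.-1 j)%:Z)%R.

Definition is_one L (T : table L) (p : position L) : bool := T p.1 p.2 == 1%R.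

Definition first_picked L (s : selection L) : position L := s.1.
Definition last_picked L (s : selection L) : position L := last s.1 s.2.

Definition erase L (T : table L) (s : selection L) : table L :=
  fun l j => if (l, j) \in s.1 :: s.2 then 0%R else T l j.

Definition select_right L (T : table L) (s : selection L) : Prop :=
  [/\ s.1.1 = 1, is_one T s.1 & forall j : 'I_L, is_one T (1, j) -> j <= s.1.2]
  /\ path (fun p q => [&& q.1 == p.1.+1, is_one T q & p.2 <= q.2]) s.1 s.2
  /\ forall j : 'I_L, (last_picked s).2 <= j -> ~~ is_one T ((last_picked s).1.+1, j).

Definition lowest_one L (T : table L) (p : position L) : Prop :=
  is_one T p /\ forall q, is_one T q -> q.1 <= p.1.

Definition nearest_left L (T : table L) (p q : position L) : bool :=
  [&& p.1 == q.1.+1, is_one T q, q.2 <= p.2 &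
   [forall j : 'I_L, is_one T (q.1, j) && (j <= p.2) ==> (j <= q.2)]].

Definition select_left L (T : table L) (s : selection L) : Prop :=
  [/\ lowest_one T s.1, path (nearest_left T) s.1 s.2 & (last_picked s).1 = 1].

(* ss is a list of selections obtained by successive repetitions of a step, each
   one in the table left by the previous ones. *)
Fixpoint repeated L (step : table L -> selection L -> Prop) (T : table L)
    (ss : seq (selection L)) : Prop :=
  if ss is s :: ss' then step T s /\ repeated step (erase T s) ss' else True.

Definition remaining L (T : table L) (ss : seq (selection L)) : table L :=
  foldl (@erase L) T ss.

Definition rigging L (lam : L.-tuple nat) (b : L.-tuple elt) (p : position L) :
    int :=
  let: (m, j) := p in
  (\sum_(i < L | (i < j)%N) (minn m (tnth lam i))%:Z + (local_energy b m j)%:Z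
   - 2 * \sum_(i < L | (i <= j)%N) (local_energy b m i)%:Z)%R.

Definition rc_of_positions L (lam : L.-tuple nat) (b : L.-tuple elt)
    (ps : seq (position L)) : config :=
  (tval lam, [seq (p.1, rigging lam b p) | p <- ps]).

(* Main.v *)
Require Import Defs.
From mathcomp Require Import all_boot all_order all_algebra.
From mathcomp Require Import zify.

(** The carriers of all capacities form a single object.  Let load l be the
    number of letters 2 in the carrier of capacity l.  From l to l + 1 it grows
    by 0 or 1, so the loads count the occupied slots in the initial segments of
    one half-infinite row of slots.  On a factor (x1, x2) the combinatorial R
    fills the first x2 empty slots and, at the same time, empties the first x1
    occupied ones, and the 1's in column j of the local energy distribution are
    exactly the slots filled by the j-th factor ([occupied_rcons], [mark_last]).
    Everything follows from this picture.

    The table.  Between two fillings of slot l + 1 it has to be emptied; as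
    slots are emptied and filled from the left, slot l is then filled strictly
    after the first of these two times and weakly before the second
    ([mark_interlaced]). So sending each 1 of row l + 1 to the nearest 1 of row
    l weakly on its left is injective, and it cuts the 1's of the table into
    disjoint chains that start in row 1. Erasing one chain keeps the table
    interlaced and destroys the end of no other chain ([erase_chain]). Picking
    the nearest 1's on the left, from a lowest 1, follows a chain from its end
    to row 1 by definition. Picking 1's on the right follows a chain from row 1
    to its end: starting from the rightmost 1 of row 1, interlacing leaves at
    most one 1 weakly on the right in the next row, and it is again the
    rightmost of its row ([right_path_nearest]). So both procedures enumerate
    the chain ends of the original table.

    The rows of phi are the chain ends as well, a row of length l being lengthened
    for the last time in column k when (l, k) is a chain end.  One more letter 2
    in the last factor, after i others, fills one more slot m + 1, the first
    for which the carrier of capacity m + 1 has more than i free places.  This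
    moves the end (m, k) with k the last 1 of row m, or creates a chain if
    m = 0 ([chain_end_add]).  It has to be compared with the longest singular
    row of length at least i.  The sum [slack] of the vacancy number and of the
    load never decreases along the path, and the rigging of an end (l, k) is its
    value before column k, minus l.  So a singular row of length l >= i has no
    change of slack since column k, and the carrier of capacity l has exactly i
    free places ([candidate_length]); the latter forces l <= m.  Conversely, if
    the slack for m had changed since the last filling of slot m, then slot
    m + 1 would have been filled while slot m remained occupied, hence would
    still be occupied ([last_mark]); it is empty, and so for m > 0 there
    is a singular row of length m ([open_row]).  Candidates of equal length have equal riggings,
    which is why the choices made in the construction do not matter. *)

Set Implicit Arguments.
Unset Strict Implicit.
Unset Printing Implicit Defensive.

Local Open Scope nat_scope.

(** * Carriers as a row of slots *)

Definition load (l : nat) (s : seq elt) : nat := (carrier l s).2.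

(** Slot number l + 1 holds a letter: slots are counted from 1, so that the
    first l of them make up the carrier of capacity l. *)
Definition occupied (l : nat) (s : seq elt) : bool := load l s < load l.+1 s.

Definition weight (x : elt) : nat := x.1 + x.2.

(** The local energy, with a natural number as column; columns beyond the end
    of the path get the value 0 from the default factor. *)
Definition loaded (t : seq elt) (l k : nat) : nat :=
  energy (carrier l (take k t)) (nth (0, 0) t k).

Definition mark (t : seq elt) (l k : nat) : bool :=
  loaded t l.-1 k < loaded t l k.

Lemma carrier_rcons l s x :
  carrier l (rcons s x) = (combR (carrier l s) x).2.
Proof. by rewrite /carrier foldl_rcons. Qed.

Lemma carrier_sum l s : (carrier l s).1 + (carrier l s).2 = l.
Proof.
elim/last_ind: s => [|s x IH]; first by rewrite /= addn0.
rewrite carrier_rcons /combR /Q0 /Q1 /=; lia.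
Qed.

(** In terms of letters 2 alone: those of the factor board as far as there are
    free places, and its letters 1 evict those present on arrival. *)
Lemma load_rcons l s x :
  load l (rcons s x)
  = load l s + minn (l - load l s) x.2 - minn (load l s) x.1.
Proof.
rewrite /load carrier_rcons /combR /Q0 /Q1 /=.
by have := carrier_sum l s; lia.
Qed.

Lemma load_le l s : load l s <= l.
Proof. by rewrite /load; have := carrier_sum l s; lia. Qed.

(** This is what makes the carriers of different capacities initial segments
    of one and the same row of slots. *)
Lemma loadS l s : load l s <= load l.+1 s <= (load l s).+1.
Proof.
elim/last_ind: s => [|s x IH]; first by [].
have := load_le l s; have := load_le l.+1 s.
by rewrite !load_rcons; lia.
Qed.

Lemma load_le_total l s : load l s <= \sum_(x <- s) x.2.
Proof.
elim/last_ind: s => [|s x IH]; first by rewrite big_nil.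
rewrite load_rcons big_rcons /=; lia.
Qed.

Lemma loadedE t l k :
  loaded t l k = minn (l - load l (take k t)) (nth (0, 0) t k).2.
Proof.
rewrite /loaded /energy /Q0 /load.
by have := carrier_sum l (take k t); lia.
Qed.

Lemma loaded_rcons s x l k :
  loaded (rcons s x) l k =
    if k < size s then loaded s l k
    else if k == size s then minn (l - load l s) x.2 else 0.
Proof.
rewrite !loadedE nth_rcons -cats1 take_cat.
case: ltngtP => [//|_ /=|->] /=; first by rewrite minn0.
by rewrite subnn take0 cats0.
Qed.

Lemma loaded_take t l j k : k < j -> loaded (take j t) l k = loaded t l k.
Proof. by move=> kj; rewrite !loadedE nth_take // take_takel // ltnW. Qed.

Lemma loaded_overflow t l k : size t <= k -> loaded t l k = 0.
Proof. by move=> tk; rewrite loadedE nth_default // minn0. Qed.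

Lemma mark_lt_size t l k : mark t l k -> k < size t.
Proof.
by rewrite /mark; case: (ltnP k (size t)) => // tk; rewrite !loaded_overflow.
Qed.

Lemma mark_le s x l k : mark (rcons s x) l k -> k <= size s.
Proof. by move/mark_lt_size; rewrite size_rcons. Qed.

Lemma mark_rcons s x l k :
  mark (rcons s x) l k =
    if k < size s then mark s l k
    else (k == size s) && (minn (l.-1 - load l.-1 s) x.2 < minn (l - load l s) x.2).
Proof.
rewrite /mark !loaded_rcons; case: (ltnP k (size s)) => // _.
by case: eqP.
Qed.

Lemma loadS_occupied l s : load l.+1 s = load l s + occupied l s.
Proof. by rewrite /occupied; have := loadS l s; case: ltnP; lia. Qed.

(** An occupied slot survives when the letters 1 are used up by the [load l s]
    occupied slots before it, an empty one is filled when the letters 2 are not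
    used up by the [l - load l s] empty ones before it. *)
Lemma occupied_rcons l s x :
  occupied l (rcons s x)
  = if occupied l s then x.1 <= load l s else l - load l s < x.2.
Proof.
have ll := load_le l s; rewrite {1}/occupied !load_rcons loadS_occupied.
by case: (occupied l s); rewrite ?addn0 ?addn1;
  [case: (leqP x.1)|case: (ltnP _ x.2)]; lia.
Qed.

Lemma mark_last l s x :
  mark (rcons s x) l.+1 (size s) = ~~ occupied l s && (l - load l s < x.2).
Proof.
have ll := load_le l s; rewrite mark_rcons ltnn eqxx /= loadS_occupied.
by case: (occupied l s); rewrite ?addn0 ?addn1 /=; lia.
Qed.

Lemma mark_init l s x k : k < size s -> mark (rcons s x) l k = mark s l k.
Proof. by move=> ks; rewrite mark_rcons ks. Qed.

Lemma mark_rcons_inv l s x k : mark (rcons s x) l.+1 k ->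
  [/\ k = size s, ~~ occupied l s & l - load l s < x.2]
  \/ (k < size s /\ mark s l.+1 k).
Proof.
case: (ltnP k (size s)) => ks mk; first by right; rewrite mark_init in mk.
have E: k = size s by apply/eqP; rewrite eqn_leq ks -ltnS -(size_rcons s x)
  (mark_lt_size mk).
by left; move: mk; rewrite E mark_last => /andP [].
Qed.

Lemma mark_row_gt0 t l k : mark t l k -> 0 < l.
Proof. by rewrite /mark; case: l => //=; rewrite ltnn. Qed.

Lemma mark_row_le t l k : mark t l k -> l <= \sum_(x <- t) x.2.
Proof.
elim/last_ind: t => [|s x IH]; first by move/mark_lt_size.
rewrite mark_rcons big_rcons /=; case: ifP => _; first by move/IH; lia.
have := load_le_total l s; have := loadS l.-1 s.
by case: l {IH} => [|l] /=; lia.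
Qed.

Lemma loadedS t l k : loaded t l k <= loaded t l.+1 k <= (loaded t l k).+1.
Proof. by rewrite !loadedE; have := loadS l (take k t); lia. Qed.

Lemma mark_loaded t l k :
  mark t l k -> loaded t l k = l - load l (take k t).
Proof.
rewrite /mark !loadedE; case: l => [|l] /=; first by rewrite ltnn.
by have := loadS l (take k t); lia.
Qed.

(** * Vacancy numbers and riggings of a path *)

(** The vacancy number of the rigged configuration of a path, with the sum over
    the rows of the configuration expressed by local energies; the equality of
    the two sums is part of the invariant [tracks]. *)
Definition path_vacancy (m : nat) (s : seq elt) : int :=
  ((\sum_(x <- s) minn m (weight x))%:Z
   - 2 * (\sum_(k < size s) loaded s m k)%:Z)%R.

(** It grows at each factor by the part of [minn m (weight x)] that neither fills
    nor empties one of the first m slots, see [slack_rcons]; this is what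
    makes it a monotone quantity, unlike the vacancy number. *)
Definition slack (m : nat) (s : seq elt) : int :=
  (path_vacancy m s + (load m s)%:Z)%R.

(** The rigging prescribed at the position [p]: the terms E and - 2 E of its
    column leave - E, and those of the earlier columns add up to the vacancy
    number of a shorter path. *)
Definition mark_rigging (t : seq elt) (p : nat * nat) : int :=
  (path_vacancy p.1 (take p.2 t) - (loaded t p.1 p.2)%:Z)%R.

Lemma sum_loaded_rcons s x m :
  \sum_(k < size (rcons s x)) loaded (rcons s x) m k
  = \sum_(k < size s) loaded s m k + minn (m - load m s) x.2.
Proof.
rewrite size_rcons big_ord_recr /= loaded_rcons ltnn eqxx; congr addn.
by apply: eq_bigr => k _; rewrite loaded_rcons ltn_ord.
Qed.

Lemma path_vacancy_rcons m s x :
  path_vacancy m (rcons s x) =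
  (path_vacancy m s + (minn m (weight x))%:Z - 2 * (minn (m - load m s) x.2)%:Z)%R.
Proof. by rewrite /path_vacancy sum_loaded_rcons big_rcons /=; lia. Qed.

Lemma slack_rcons m s x :
  slack m (rcons s x) =
  (slack m s + (minn m (weight x) - minn (m - load m s) x.2
                - minn (load m s) x.1)%N%:Z)%R.
Proof.
rewrite /slack path_vacancy_rcons load_rcons /weight.
by have := load_le m s; lia.
Qed.

(** No letter is wasted when all of the first m slots change, or when none of
    the changes takes place beyond them. *)
Lemma slack_rcons_eq m s x :
    (m - load m s <= x.2) && (load m s <= x.1)
    || (x.2 <= m - load m s) && (x.1 <= load m s) ->
  slack m (rcons s x) = slack m s.
Proof.
rewrite slack_rcons /weight; have := load_le m s.
by move=> ? /orP [] /andP [? ?]; lia.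
Qed.

Lemma slack_take_le m k s : (slack m (take k s) <= slack m s)%R.
Proof.
elim/last_ind: s => [|s x IH]; first by [].
case: (leqP k (size s)) => ks; last by rewrite take_oversize ?size_rcons.
rewrite -cats1 takel_cat // cats1 slack_rcons; lia.
Qed.

(** At the moment of a mark the carrier of capacity m becomes full, which turns
    its energy into [m - load]. *)
Lemma mark_rigging_slack t m k :
  mark t m k -> mark_rigging t (m, k) = (slack m (take k t) - m%:Z)%R.
Proof.
move=> /mark_loaded ml; rewrite /mark_rigging /slack /= ml.
by have := load_le m (take k t); lia.
Qed.

(** Slot m + 1 stays occupied after its last filling, so each later factor
    spends its letters 1 on the slots before it.  If slot m + 2 is filled at
    that time or later, or if a factor is wasteful for the first m + 1 slots,
    which means that it has letters 2 left for the slots beyond, then slot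
    m + 2 is occupied, and remains so because slot m + 1 would have to
    be emptied first. *)
Lemma last_mark s m : occupied m s ->
  exists j, [/\ mark s m.+1 j, forall k, mark s m.+1 k -> k <= j &
    occupied m.+1 s \/
    (forall k, mark s m.+2 k -> k < j) /\ slack m.+1 (take j s) = slack m.+1 s].
Proof.
elim/last_ind: s => [|s x IH] //.
have lm := load_le m s; have lm1 := load_le m.+1 s.
have := loadS_occupied m s; rewrite !occupied_rcons.
case om: (occupied m s) => lS => [oldm|newm]; last first.
  exists (size s); split.
  - by rewrite mark_last om.
  - by move=> k /mark_lt_size; rewrite size_rcons ltnS.
  rewrite -cats1 take_size_cat // cats1.
  case: ifP => om1; case: leqP => e; try by [left]; right.
  - split; last by rewrite slack_rcons_eq //; lia.
    by move=> k /mark_rcons_inv [[_]|[]//]; rewrite om1.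
  - split; last by rewrite slack_rcons_eq //; lia.
    by move=> k /mark_rcons_inv [[_ _]|[]//]; lia.
have [j [mj jmax alt]] := IH om; have js := mark_lt_size mj.
exists j; split.
- by rewrite mark_init.
- by move=> k /mark_rcons_inv [[_]|[_ /jmax//]]; rewrite om.
case: alt => [->|[nj E]]; first by left; lia.
case: ifP => om1; first by left; lia.
case: leqP => e; [right|by left].
rewrite -cats1 takel_cat ?(ltnW js) // cats1 E slack_rcons_eq; last by lia.
split=> // k /mark_rcons_inv [[_ _]|[_ /nj//]]; lia.
Qed.

(** * Interlacing of consecutive rows *)

(** The first clause is the second one for a fictitious 1 of row [l.+1] to the
    left of all columns. *)
Definition interlaced (A : nat -> nat -> bool) : Prop :=
  forall l c, 0 < l -> A l.+1 c ->
    (exists2 a, A l a & a <= c)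
    /\ forall c', A l.+1 c' -> c' < c -> exists2 a, A l a & c' < a <= c.

(** When slot l + 1 is emptied, slot l is empty afterwards unless it is filled by
    the same factor; when slot l + 1 is filled again, slot l is occupied or
    filled by the same factor.  So slot l has been filled in between. *)
Lemma mark_interlaced t : interlaced (mark t).
Proof.
case=> // l c _.
(* The second part prepares the next filling of slot l + 2: if that slot is
   empty and slot l + 1 is not, the mark in row l + 1 must exist already. *)
suff: (forall c, mark t l.+2 c ->
        (exists2 a, mark t l.+1 a & a <= c)
        /\ forall c', mark t l.+2 c' -> c' < c ->
           exists2 a, mark t l.+1 a & c' < a <= c)
    /\ (occupied l t -> ~~ occupied l.+1 t ->
        (exists a, mark t l.+1 a)
        /\ forall c', mark t l.+2 c' -> exists2 a, mark t l.+1 a & c' < a).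
  by case=> + _; apply.
elim/last_ind: t => [|s x [IH1 IH2]] {c}; first by split=> // c /mark_lt_size.
have ll := load_le l s; have lS := loadS_occupied l s.
have up a : mark s l.+1 a -> mark (rcons s x) l.+1 a.
  by move=> ma; rewrite mark_rcons (mark_lt_size ma).
split=> [c /mark_rcons_inv [[-> nol1 e]|[cs mc]]|].
- case ol: (occupied l s); last first.
    have mx: mark (rcons s x) l.+1 (size s).
      by rewrite mark_last ol; lia.
    by split=> [|c' _ c's]; exists (size s); rewrite // leqnn c's.
  have [[a ma] H] := IH2 ol nol1.
  split; first by exists a; [exact: up|exact/ltnW/(mark_lt_size ma)].
  move=> c' /mark_rcons_inv [[->]|[c's /H[b mb bc] _]]; first by rewrite ltnn.
  by exists b; [exact: up|rewrite bc (ltnW (mark_lt_size mb))].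
- have [[a ma ac] H] := IH1 c mc.
  split; first by exists a; first exact: up.
  move=> c' /mark_rcons_inv [[-> _ _]|[c's /H{}H /H[b mb bc]]].
    by rewrite ltnNge ltnW.
  by exists b; first exact: up.
rewrite !occupied_rcons; case ol: (occupied l s) lS => lS e; last first.
  have mx: mark (rcons s x) l.+1 (size s) by rewrite mark_last ol.
  move=> no; split; first by exists (size s).
  move=> c' /mark_rcons_inv [[_ /negbTE E]|[]]; last by exists (size s).
  by move: no; rewrite E => /negP.
case: ifP => [_|/negbT/(IH2 ol) [[a ma] H] no]; first by lia.
split; first by exists a; exact: up.
move=> c' /mark_rcons_inv [[_ _ e3]|[_ /H[b mb bc]]]; first by rewrite e3 in no.
by exists b; first exact: up.
Qed.

(** * Chain ends *)

(** In an interlaced table the chains join each position of row l + 1 to the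
    nearest position of row l weakly on its left.  A position is the last one
    of its chain when each position weakly on its right in the next row has a
    nearer one to be joined to. *)
Definition chain_end (A : nat -> nat -> bool) (p : nat * nat) : Prop :=
  A p.1 p.2 /\
  forall c, A p.1.+1 c -> p.2 <= c -> exists2 a, A p.1 a & p.2 < a <= c.

Lemma chain_end_ext A A' p :
  (forall l k, A' l k = A l k) -> chain_end A' p <-> chain_end A p.
Proof.
move=> e; rewrite /chain_end e; split=> -[Ap H]; split=> // c.
  by rewrite -e => /H{}H /H [a]; rewrite e; exists a.
by rewrite e => /H{}H /H [a]; rewrite -e; exists a.
Qed.

(** The last position (m, k0) of row m ceases to be an end as it is the nearest
    one on the left of the new position, and it separates the other positions
    of row m from the new one.  If row m is empty, as for m = 0, [k0] is
    arbitrary. *)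
Lemma chain_end_add A A' m k0 j :
    (forall l k, A' l k = A l k || ((l, k) == (m.+1, j))) ->
    (forall l k, A l k -> k <= j) -> ~~ A m.+2 j ->
    (forall k, A m k -> A m k0 /\ k <= k0) ->
  forall p, chain_end A' p <-> p = (m.+1, j) \/ chain_end A p /\ p <> (m, k0).
Proof.
move=> A'E Aj nj k0max [l k]; rewrite /chain_end /=; split=> [[]|].
  rewrite A'E => /orP [Alk H|/eqP->]; [right|by left].
  split; first split=> // c Ac kc.
    have [|a] := H c _ kc; first by rewrite A'E Ac.
    rewrite A'E => /orP [Aa|/eqP [el ea]] /andP [ka ac].
      by exists a; rewrite ?ka.
    have cj := Aj _ _ Ac; case/negP: nj.
    by have -> : j = c by [lia]; rewrite -el.
  case=> el ek; move: Alk H; rewrite el ek => Ak H.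
  have [|a] := H j _ (Aj _ _ Ak); first by rewrite A'E eqxx orbT.
  rewrite A'E => /orP [/k0max[_ ?]|/eqP []]; lia.
case=> [[-> ->]|[[Alk H] ne]].
  split; first by rewrite A'E eqxx orbT.
  move=> c; rewrite A'E => /orP [Ac|/eqP []]; last by lia.
  by move=> jc; case/negP: nj; have <- : c = j by have := Aj _ _ Ac; lia.
split; first by rewrite A'E Alk.
move=> c; rewrite A'E => /orP [Ac|/eqP [el ec]] kc.
  by have [a Aa ?] := H c Ac kc; exists a; rewrite // A'E Aa.
rewrite el in Alk ne *; have [Ak0 kk0] := k0max _ Alk.
exists k0; first by rewrite A'E Ak0.
have ? : k <> k0 by move=> e; apply: ne; rewrite e.
by have := Aj _ _ Ak0; lia.
Qed.

(** * The invariant of the construction of phi *)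

Definition rows_at (t : seq elt) (ps : seq (nat * nat)) : seq (nat * int) :=
  [seq (p.1, mark_rigging t p) | p <- ps].

(** The invariant that relates a configuration to a path: its rows are the chain
    ends of the marks.  The last clause allows the vacancy numbers, in which
    the rows enter, to be read off from the energies. *)
Definition tracks (t : seq elt) (rows : seq (nat * int)) : Prop :=
  exists ps, [/\ uniq ps, forall p, p \in ps <-> chain_end (mark t) p,
    perm_eq rows (rows_at t ps)
    & forall m, \sum_(p <- ps) minn m p.1 = \sum_(k < size t) loaded t m k].

Lemma tracks_ext t t' rows :
    (forall l k, loaded t' l k = loaded t l k) ->
    (forall p, mark t p.1 p.2 -> mark_rigging t' p = mark_rigging t p) ->
    (forall m, \sum_(k < size t') loaded t' m k
               = \sum_(k < size t) loaded t m k) ->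
  tracks t rows -> tracks t' rows.
Proof.
move=> eL eR eS [ps [ups psP prows sum_ps]]; exists ps; split=> //.
- by move=> p; rewrite psP; apply: chain_end_ext => l k; rewrite /mark !eL.
- rewrite (perm_trans prows) // (_ : rows_at t' ps = rows_at t ps) //.
  by apply/eq_in_map => p /psP [mp _]; rewrite eR.
by move=> m; rewrite eS sum_ps.
Qed.

Lemma take_rcons_le (T : Type) k (s : seq T) y :
  k <= size s -> take k (rcons s y) = take k s.
Proof. by move=> ks; rewrite -cats1 takel_cat. Qed.

Lemma mark_rigging_rcons s y y' p : p.2 <= size s ->
    loaded (rcons s y') p.1 p.2 = loaded (rcons s y) p.1 p.2 ->
  mark_rigging (rcons s y') p = mark_rigging (rcons s y) p.
Proof. by move=> ks e; rewrite /mark_rigging !take_rcons_le // e. Qed.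

(** The energies in the last column depend only on the letters 2 of the last
    factor. *)
Lemma tracks_factor_one s a b rows :
  tracks (rcons s (a, b)) rows -> tracks (rcons s (a.+1, b)) rows.
Proof.
have eL l k : loaded (rcons s (a.+1, b)) l k = loaded (rcons s (a, b)) l k.
  by rewrite !loaded_rcons.
apply: tracks_ext => // [p|m]; last by rewrite !sum_loaded_rcons.
by move/mark_lt_size; rewrite size_rcons ltnS => ps; apply: mark_rigging_rcons.
Qed.

Lemma tracks_factor_start t rows :
  tracks t rows -> tracks (rcons t (0, 0)) rows.
Proof.
have eL l k : loaded (rcons t (0, 0)) l k = loaded t l k.
  rewrite loaded_rcons minn0 /=; case: ltnP => // tk.
  by rewrite loaded_overflow //; case: ifP.
apply: tracks_ext => // [p /mark_lt_size pt|m].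
  by rewrite /mark_rigging eL take_rcons_le // ltnW.
by rewrite sum_loaded_rcons minn0 addn0.
Qed.

Lemma sum_Posz (T : Type) (s : seq T) (P : pred T) (F : T -> nat) :
  (\sum_(x <- s | P x) (F x)%:Z)%R = Posz (\sum_(x <- s | P x) F x).
Proof. by rewrite (big_morph Posz PoszD (erefl _)). Qed.

Lemma vacancyE nu mu m t :
    \sum_(k <- nu) minn m k = \sum_(x <- t) minn m (weight x) ->
    \sum_(k <- mu) minn m k = \sum_(k < size t) loaded t m k ->
  vacancy nu mu m = path_vacancy m t.
Proof. by move=> e1 e2; rewrite /vacancy !sum_Posz e1 e2. Qed.

Lemma sum_unzip1 t m ps rows : perm_eq rows (rows_at t ps) ->
  \sum_(k <- unzip1 rows) minn m k = \sum_(p <- ps) minn m p.1.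
Proof. by move=> pr; rewrite big_map (perm_big _ pr) big_map. Qed.

(** The quantum space when the part [y] of the current factor has been
    processed; no row is created before its first letter. *)
Definition quantum (s : seq elt) (y : elt) : seq nat :=
  if weight y == 0 then map weight s else rcons (map weight s) (weight y).

Lemma quantum_sum s y m :
  \sum_(k <- quantum s y) minn m k = \sum_(x <- rcons s y) minn m (weight x).
Proof.
rewrite /quantum big_rcons /=; case: eqP => [->|_].
  by rewrite big_map minn0 addn0.
by rewrite big_rcons big_map.
Qed.

Lemma incr_nth_rcons s i : incr_nth (rcons s i) (size s) = rcons s i.+1.
Proof. by elim: s => //= x s ->. Qed.

Lemma add_box_quantum s y y' : weight y' = (weight y).+1 ->
  add_box (weight y) (quantum s y) = quantum s y'.
Proof.
move=> e; rewrite /quantum e /=; case: (weight y) => [|i] //=.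
by rewrite size_rcons /= incr_nth_rcons.
Qed.

(** The partly processed factor [y] is treated as a factor of its own, which is
    legitimate as the energies of (0, i) are those created by the first i
    letters 2. *)
Definition factor_state (s : seq elt) (y : elt) (rc : config) : Prop :=
  rc.1 = quantum s y /\ tracks (rcons s y) rc.2.

Lemma factor_state_one s a b rc rc' :
  factor_state s (a, b) rc -> kkr_letter (a + b) rc 1 rc' ->
  factor_state s (a.+1, b) rc'.
Proof.
case=> [q tr] step; inversion_clear step.
split; last exact: tracks_factor_one.
by rewrite /= q (@add_box_quantum s (a, b) (a.+1, b)).
Qed.

(** Slot m + 1 is the empty slot number i + 1: it is the one that the next
    letter 2 fills after i letters 2 of the same factor. *)
Lemma next_mark i s : exists m,
  [/\ m - load m s = i, load m.+1 s = load m s &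
      forall l, (i < l - load l s) = (m < l)].
Proof.
have ex : exists l, i < l - load l s.
  (* A carrier larger than the number of letters 2 by i + 1 is large enough. *)
  exists (\sum_(x <- s) x.2 + i.+1).
  by have := load_le_total (\sum_(x <- s) x.2 + i.+1) s; lia.
case: (ex_minnP ex) => -[|m] // mP mmin; exists m.
have mi : m - load m s <= i by rewrite leqNgt; apply/negP => /mmin; rewrite ltnn.
have lS := loadS m s; have lm := load_le m s; split; [lia|lia|].
move=> l; apply/idP/idP => [/mmin//|].
elim: l => // l IH; rewrite ltnS leq_eqVlt => /orP [/eqP<-//|/IH].
by have := loadS l s; lia.
Qed.

(** * Processing a letter 2 *)

Section LetterTwo.

Variables (s : seq elt) (i m : nat).
Hypothesis mi : m - load m s = i.
Hypothesis mS : load m.+1 s = load m s.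
Hypothesis mP : forall l, (i < l - load l s) = (m < l).

Let t := rcons s (0, i).
Let t' := rcons s (0, i.+1).

Lemma loaded_two l k : loaded t' l k = loaded t l k + ((k == size s) && (m < l)).
Proof.
rewrite !loaded_rcons -mP /=; case: ltngtP => _; rewrite ?addn0 //=.
by lia.
Qed.

Lemma mark_two l k : mark t' l k = mark t l k || ((l, k) == (m.+1, size s)).
Proof.
rewrite /mark !loaded_two xpair_eqE; case: (eqVneq k (size s)) => [->|_] /=; last first.
  by rewrite !addn0 andbF orbF.
rewrite !loaded_rcons ltnn eqxx andbT /=.
case: (eqVneq l m.+1) => [->|lm] /=; first by rewrite mS; have := load_le m s; lia.
by rewrite orbF (_ : (m < l.-1) = (m < l)) ?ltn_add2r //; lia.
Qed.

Lemma mark_two_last : ~~ mark t m.+2 (size s).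
Proof.
rewrite mark_last negb_and -leqNgt; apply/orP; right.
by rewrite /= ltnW // mP.
Qed.

Lemma mark_rigging_two p : mark t p.1 p.2 -> mark_rigging t' p = mark_rigging t p.
Proof.
move=> mp; apply: mark_rigging_rcons (mark_le mp) _; rewrite loaded_two.
case: eqP => [e|_]; last by rewrite addn0.
case: ltnP => [mp1|_]; last by rewrite addn0.
case: p e mp mp1 => -[|l] k /= -> //; rewrite mark_last.
move=> /andP [_ /= li]; rewrite ltnS leq_eqVlt => /orP [/eqP ml|].
  by rewrite -ml mi ltnn in li.
by rewrite -mP; lia.
Qed.

Lemma sum_loaded_two l :
  \sum_(k < size t') loaded t' l k = \sum_(k < size t) loaded t l k + (m < l).
Proof.
by rewrite !sum_loaded_rcons -mP -addnA; congr addn; rewrite /=; lia.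
Qed.

Lemma mark_rigging_new : mark_rigging t' (m.+1, size s) = path_vacancy m.+1 t'.
Proof.
rewrite /mark_rigging take_rcons_le // take_size loaded_rcons ltnn eqxx.
rewrite path_vacancy_rcons /weight /=.
by have := load_le m s; lia.
Qed.

(** For a row of length l >= i with mark in column k, the vacancy number minus
    the rigging is the growth of the slack since column k plus the absolute
    value of [l - load l s - i], a sum of two nonnegative terms. *)
Lemma candidate_length rc row : factor_state s (0, i) rc -> candidate i rc row ->
  0 < row.1 /\ row.1 - load row.1 s = i.
Proof.
move=> [q [ps [ups psP prows sum_ps]]] /and3P [].
rewrite (perm_mem prows) /singular => /mapP [[l k] /psP [/= mk _] -> /=] + il.
rewrite (@vacancyE _ _ _ t) ?q ?quantum_sum ?(sum_unzip1 _ prows) //.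
move/eqP; rewrite (mark_rigging_slack mk) take_rcons_le ?(mark_le mk) //.
rewrite path_vacancy_rcons.
have := slack_take_le l k s; have := load_le l s.
rewrite {2}/slack /weight /= (mark_row_gt0 mk) => H1 H2 H3; split=> //.
case: (leqP (l - load l s) i) => ?; lia.
Qed.

(** Either slot m is filled by the letters of the current factor that have
    already been processed, or it was occupied before and [last_mark] applies,
    slot m + 1 being empty. *)
Lemma open_row : 0 < m -> exists k,
  [/\ mark t m k, forall k', mark t m k' -> k' <= k,
      forall k', mark t m.+1 k' -> k' < k
    & mark_rigging t (m, k) = path_vacancy m t].
Proof.
case: m mi mS mP => // n; rewrite /t => ni nS nP _.
have ll := load_le n s; have l1 := loadS_occupied n s.
case on: (occupied n s) l1 => l1; last first.
  have mx : mark (rcons s (0, i)) n.+1 (size s) by rewrite mark_last on /=; lia.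
  exists (size s); split=> //; first by move=> k' /mark_le.
    move=> k' /mark_rcons_inv [[_ _ /=]|[]//].
    by rewrite ni ltnn.
  rewrite /mark_rigging take_rcons_le // take_size loaded_rcons ltnn eqxx.
  rewrite path_vacancy_rcons /weight /=.
  lia.
have [k [mk kmax alt]] := last_mark on; have ks := mark_lt_size mk.
case: alt => [|[k1 E]]; first by rewrite /occupied nS ltnn.
have mx : mark (rcons s (0, i)) n.+1 k by rewrite mark_init.
exists k; split=> //.
- by move=> k' /mark_rcons_inv [[_ ]|[_ /kmax//]]; rewrite on.
- by move=> k' /mark_rcons_inv [[_ _]|[_ /k1//]]; rewrite /= ni ltnn.
rewrite mark_rigging_slack // take_rcons_le ?(ltnW ks) // E.
rewrite /slack path_vacancy_rcons /weight /=.
by have := load_le n.+1 s; lia.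
Qed.

(** Creation and lengthening at once: for m = 0 no row has length 0, so that
    [rem (m, k0) ps] is just [ps]. *)
Lemma tracks_two ps k0 rest :
    uniq ps -> (forall p, p \in ps <-> chain_end (mark t) p) ->
    (forall l, \sum_(p <- ps) minn l p.1 = \sum_(k < size t) loaded t l k) ->
    (forall k, mark t m k -> mark t m k0 /\ k <= k0) ->
    (0 < m -> (m, k0) \in ps) ->
    perm_eq rest (rows_at t (rem (m, k0) ps)) ->
  factor_state s (0, i.+1) (add_singular (quantum s (0, i.+1)) m.+1 rest).
Proof.
move=> ups psP sum_ps k0P m0 prest.
set ps' := (m.+1, size s) :: rem (m, k0) ps.
have notin : (m.+1, size s) \notin ps.
  apply/negP => /psP [/= + _]; rewrite mark_last.
  by rewrite mi ltnn andbF.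
have sum_ps' l : \sum_(p <- ps') minn l p.1 = \sum_(k < size t') loaded t' l k.
  rewrite sum_loaded_two -sum_ps big_cons /=.
  case: (posnP m) => [m_0|/m0 inps]; last by rewrite (big_rem _ inps) /=; lia.
  rewrite rem_id; last first.
    by apply/negP => /psP [/mark_row_gt0 /=]; rewrite m_0.
  by rewrite m_0; lia.
have eR : rows_at t' (rem (m, k0) ps) = rows_at t (rem (m, k0) ps).
  by apply/eq_in_map => p /mem_rem/psP [mp _]; rewrite mark_rigging_two.
split=> //=; exists ps'; split=> //.
- by rewrite /= rem_uniq // andbT; apply: contra notin => /mem_rem.
- move=> p; rewrite inE mem_rem_uniq // inE.
  rewrite (chain_end_add (A := mark t) mark_two _ mark_two_last (k0 := k0)).
  + rewrite -psP; split.
      by case/orP=> [/eqP|/andP [/eqP]]; [left|right].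
    by case=> [->|[-> /eqP ->]]; rewrite ?eqxx ?orbT.
  + by move=> l k /mark_le.
  + exact: k0P.
- rewrite /= mark_rigging_new -(@vacancyE (quantum s (0, i.+1)) (m.+1 :: unzip1 rest)).
  + by rewrite perm_cons eR.
  + exact: quantum_sum.
  + by rewrite big_cons (sum_unzip1 _ prest) -sum_ps' big_cons.
Qed.

(** The construction may lengthen a singular row other than the one of the chain
    end (m, k), but only one with the same length and the same rigging, and
    configurations keep track of nothing else. *)
Lemma factor_state_two_at rc rc' :
  factor_state s (0, i) rc -> kkr_letter i rc 2 rc' ->
  factor_state s (0, i.+1) rc'.
Proof.
move=> st; have [q [ps [ups psP prows sum_ps]]] := st.
have vacancy_m : vacancy rc.1 (unzip1 rc.2) m = path_vacancy m t.
  by apply: vacancyE; rewrite ?q ?quantum_sum ?(sum_unzip1 _ prows).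
have qS : add_box i rc.1 = quantum s (0, i.+1).
  by rewrite q (@add_box_quantum s (0, i) (0, i.+1)).
have cand k : (m, k) \in ps -> mark_rigging t (m, k) = path_vacancy m t ->
    candidate i rc (m, path_vacancy m t).
  move=> mk e; rewrite /candidate /singular vacancy_m eqxx /= (perm_mem prows) -e.
  by rewrite (map_f (fun p => (p.1, mark_rigging t p)) mk) -mi leq_subr.
have open : 0 < m -> exists k,
    [/\ (m, k) \in ps, mark_rigging t (m, k) = path_vacancy m t &
    forall k', mark t m k' -> mark t m k /\ k' <= k].
  move=> /open_row [k [mk kmax kS e]]; exists k; split=> //; last by move=> ? /kmax.
  by apply/psP; split=> // c /= /kS; rewrite ltnNge => /negbTE ->.
move=> step; inversion_clear step as [|no|row rowP row_max].
  have m_0 : m = 0.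
    case: (posnP m) => // /open [k [mk e _]].
    by have := cand k mk e; rewrite (negbTE (no _)).
  have n0 k : (m, k) \notin ps.
    by apply/negP => /psP [/mark_row_gt0 /=]; rewrite m_0.
  rewrite qS -[1]/(0.+1) -[in 0.+1]m_0.
  apply: (tracks_two (k0 := 0)) ups psP sum_ps _ _ _; rewrite ?m_0 //.
    by move=> k /mark_row_gt0.
  by rewrite rem_id // -m_0.
have [row0 rowi] := candidate_length st rowP.
have rowm : row.1 <= m by rewrite leqNgt -mP rowi ltnn.
have m0 : 0 < m by apply: leq_trans row0 rowm.
have [k [mk e kmax]] := open m0.
have {}rowm : row.1 = m.
  by apply/eqP; rewrite eqn_leq rowm; apply: (row_max _ (cand k mk e)).
have rowE : row = (m, mark_rigging t (m, k)).
  rewrite (surjective_pairing row) rowm e.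
  by move: rowP => /and3P [_ /eqP -> _]; rewrite rowm vacancy_m.
have inrows : row \in rc.2 by case/and3P: rowP.
rewrite qS rowm; apply: (tracks_two (k0 := k)) ups psP sum_ps kmax _ _ => //.
rewrite -(perm_cons row) -(permPl (perm_to_rem inrows)) (permPl prows) rowE.
exact: (perm_map _ (perm_to_rem mk)).
Qed.

End LetterTwo.

Lemma factor_state_two s i rc rc' :
  factor_state s (0, i) rc -> kkr_letter i rc 2 rc' -> factor_state s (0, i.+1) rc'.
Proof. by have [m [? ? ?]] := next_mark i s; apply: (@factor_state_two_at s i m). Qed.

(** * Complete factors and complete paths *)

Lemma kkr_word_cat i rc w1 w2 rc' :
  kkr_word i rc (w1 ++ w2) rc' <->
  exists rc1, kkr_word i rc w1 rc1 /\ kkr_word (i + size w1) rc1 w2 rc'.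
Proof.
elim: w1 i rc => [|a w IH] i rc /=.
  by rewrite addn0; split=> [|[_ [->]]//]; exists rc.
split=> [[rc1 [step /IH [rc2 [H1 H2]]]]|[rc2 [[rc1 [step H1]] H2]]].
  by exists rc2; rewrite addnS; split=> //; exists rc1.
by exists rc1; split=> //; apply/IH; exists rc2; rewrite addSnnS.
Qed.

Lemma factor_state_twos s n i rc rc' :
  factor_state s (0, i) rc -> kkr_word i rc (nseq n 2) rc' ->
  factor_state s (0, i + n) rc'.
Proof.
elim: n i rc => [|n IH] i rc st /=; first by rewrite addn0 => ->.
by case=> rc1 [/(factor_state_two st) /IH H /H]; rewrite addSnnS.
Qed.

Lemma factor_state_ones s n a b rc rc' : factor_state s (a, b) rc ->
  kkr_word (a + b) rc (nseq n 1) rc' -> factor_state s (a + n, b) rc'.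
Proof.
elim: n a rc => [|n IH] a rc st /=; first by rewrite addn0 => ->.
by case=> rc1 [/(factor_state_one st) /IH H /H]; rewrite addSnnS.
Qed.

Lemma factor_state_done s x rc rc' :
  factor_state s (0, 0) rc -> kkr_word 0 rc (letters x) rc' -> factor_state s x rc'.
Proof.
move=> st /kkr_word_cat [rc1 [/(factor_state_twos st) st1]].
rewrite size_nseq; case: x st1 => a b /= st1.
by move/(factor_state_ones (a := 0) st1).
Qed.

(** A complete factor counts as a path whose next factor is (0, 0), since a
    factor without letters does not change the energies. *)
Lemma kkr_pathP s b rc rc' : all (fun x => 0 < weight x) b ->
    rc.1 = map weight s -> tracks s rc.2 -> kkr_path rc b rc' ->
  rc'.1 = map weight (s ++ b) /\ tracks (s ++ b) rc'.2.
Proof.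
elim: b s rc => [|x b IH] s rc /=; first by rewrite cats0 => _ ? ? ->.
move=> /andP [x0 b0] q tr [rc1 [wx]]; rewrite -cat_rcons.
have [|q1 tr1] := @factor_state_done s x rc rc1 _ wx.
  by split; [rewrite q|exact: tracks_factor_start].
apply: IH => //; rewrite q1 /quantum map_rcons.
by case: eqP x0 => // ->.
Qed.

Lemma kkr_letter_total i rc a : (a == 1) || (a == 2) ->
  exists rc', kkr_letter i rc a rc'.
Proof.
case/orP=> /eqP ->; first by exists (add_box i rc.1, rc.2); constructor.
case: (boolP (has (candidate i rc) rc.2)) => [/hasP [row0 in0 c0]|no].
  have ex : exists n, has (fun row => candidate i rc row && (row.1 == n)) rc.2.
    by exists row0.1; apply/hasP; exists row0; rewrite // c0 eqxx.
  have bd n : has (fun row => candidate i rc row && (row.1 == n)) rc.2 ->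
      n <= \sum_(row <- rc.2) row.1.
    by case/hasP=> row inr /andP [_ /eqP <-]; rewrite (big_rem row) //= leq_addr.
  case: (ex_maxnP ex bd) => n /hasP [row inr /andP [rowP /eqP rn]] nmax.
  exists (add_singular (add_box i rc.1) row.1.+1 (rem row rc.2)).
  apply: KkrGrow => // row' row'P; rewrite rn; apply: nmax; apply/hasP.
  by exists row'; [case/and3P: row'P|rewrite row'P eqxx].
exists (add_singular (add_box i rc.1) 1 rc.2); apply: KkrNew => row.
apply/negP => rowP; case/negP: no; apply/hasP.
by exists row => //; case/and3P: rowP.
Qed.

Lemma kkr_word_total w i rc : all (fun a => (a == 1) || (a == 2)) w ->
  exists rc', kkr_word i rc w rc'.
Proof.
elim: w i rc => [|a w IH] i rc /=; first by exists rc.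
case/andP=> /(kkr_letter_total i rc) [rc1 step] /(IH i.+1 rc1) [rc' H].
by exists rc', rc1.
Qed.

Lemma kkr_path_total b rc : exists rc', kkr_path rc b rc'.
Proof.
elim: b rc => [|x b IH] rc /=; first by exists rc.
have [|rc1 H1] := @kkr_word_total (letters x) 0 rc.
  by rewrite all_cat !all_nseq !orbT.
by have [rc' H] := IH rc1; exists rc', rc1.
Qed.

(** Every run of the construction leads to the rows given by the chain ends,
    and some run exists: together these give both directions. *)
Lemma is_phi_rows b ps rc : all (fun x => 0 < weight x) b ->
    uniq ps -> (forall p, p \in ps <-> chain_end (mark b) p) ->
  is_phi b rc <-> rc_equiv (map weight b, rows_at b ps) rc.
Proof.
move=> b0 ups psP.
have main rc0 : kkr_path ([::], [::]) b rc0 ->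
    rc_equiv (map weight b, rows_at b ps) rc0.
  case/(@kkr_pathP [::] b ([::], [::]) rc0 b0 (erefl _)) => [|/= q].
    exists [::]; split=> // [p|m]; last by rewrite big_nil big_ord0.
    by split=> // -[/mark_lt_size].
  case=> ps' [ups' ps'P prows _]; split; first by rewrite q.
  rewrite perm_sym (perm_trans prows) //; apply/perm_map/uniq_perm => // p.
  by apply/idP/idP => [/ps'P/psP|/psP/ps'P].
split=> [[rc0 [/main [e p] [e' p']]]|[e p]].
  by split; [rewrite e|rewrite (perm_trans p)].
have [rc0 H] := kkr_path_total b ([::], [::]).
have [e0 p0] := main _ H; exists rc0; split=> //; split; first by rewrite -e0.
by rewrite -(permPl p0).
Qed.

(** * Erasing a chain *)

(** A chain with end (m, a m) meets each row l, with 0 < l <= m, in the single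
    column [a l], hence a function encodes it. *)
Section EraseChain.

Variables (A : nat -> nat -> bool) (m : nat) (a : nat -> nat).
Hypothesis A0 : forall k, ~~ A 0 k.
Hypothesis A_interlaced : interlaced A.
Hypothesis a_in : forall l, 0 < l <= m -> A l (a l).
Hypothesis a_nearest : forall l, 0 < l < m ->
  a l <= a l.+1 /\ forall k, A l k -> k <= a l.+1 -> k <= a l.
Hypothesis a_end : chain_end A (m, a m).

Definition erased l k := A l k && ~~ ((0 < l <= m) && (k == a l)).

(** The key to erasure: whatever an unerased position of row l + 1 needs in row
    l, it can find further right if the erased chain has taken it.  Interlacing puts
    a position of row l between [a l.+1] and any other position of row l + 1; as
    there is none between [a l] and [a l.+1], only positions on the right of
    [a l.+1] can need [a l], and for them the position in between will do.  For
    l = m it exists because (m, a m) is an end. *)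
Lemma erased_witness l c k : erased l.+1 c -> A l k -> k <= c ->
  exists2 k', erased l k' & k <= k' <= c.
Proof.
move=> /andP [Ac nc] Ak kc; have l0 : 0 < l.
  by case: l Ak {Ac nc} => // Ak; have := A0 k; rewrite Ak.
case: (boolP (erased l k)) => [e|]; first by exists k; rewrite ?leqnn.
rewrite negb_and Ak /= negbK l0 /= => /andP [lm /eqP ka].
suff [k' Ak' kk'] : exists2 k', A l k' & a l < k' <= c.
  by exists k'; [rewrite /erased Ak'|]; lia.
move: lm; rewrite leq_eqVlt => /orP [/eqP lm|lm].
  have [_ H] := a_end; rewrite -lm /= in H; apply: H => //; by rewrite -ka.
have [al near] := a_nearest (l := l) ltac:(lia).
have aS := a_in (l := l.+1) ltac:(lia).
have ca : c <> a l.+1 by move=> e; case/negP: nc; rewrite e eqxx andbT.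
case: (ltnP c (a l.+1)) => cl.
  have [_ /(_ c Ac cl) [k' Ak' /andP [ck' k'a]]] := A_interlaced l0 aS.
  by have := near _ Ak' k'a; lia.
have [_ /(_ _ aS) [|k' Ak' ?]] := A_interlaced l0 Ac; first by lia.
by exists k' => //; lia.
Qed.

Lemma erased_interlaced : interlaced erased.
Proof.
move=> l c l0 ec; have /andP [Ac _] := ec.
have [[k Ak kc] H] := A_interlaced l0 Ac; split.
  by have [k' ek' ?] := erased_witness ec Ak kc; exists k'; lia.
move=> c' /andP [Ac' _] c'c; have [k0 Ak0 /andP [? k0c]] := H _ Ac' c'c.
by have [k' ek' ?] := erased_witness ec Ak0 k0c; exists k'; lia.
Qed.

(** A position of the erased chain other than (m, a m) was no end, since no
    position of row l separates [a l] from [a l.+1].  For a position that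
    remains, [erased_witness] replaces the positions that are lost, and [a l]
    itself separates it from the lost [a l.+1]. *)
Lemma erased_chain_end p :
  chain_end erased p <-> chain_end A p /\ p <> (m, a m).
Proof.
case: p => l k; split=> [[/= ek H]|[[/= Ak H] ne]].
  have /andP [Ak nk] := ek; split; last first.
    case=> el ea; case/negP: nk; rewrite el ea leqnn eqxx !andbT.
    by rewrite lt0n; apply/eqP => m0; move: Ak; rewrite el m0 (negbTE (A0 _)).
  split=> //= c Ac kc; case: (boolP (erased l.+1 c)) => [ec|].
    by have [k' /andP [Ak' _] ?] := H c ec kc; exists k'.
  rewrite negb_and Ac /= negbK => /andP [lm /eqP ca].
  have l0 : 0 < l by case: l Ak {ek H nk Ac lm ca} => //; rewrite (negbTE (A0 _)).
  have [al near] := a_nearest (l := l) ltac:(lia).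
  have ka : k <= a l by apply: near; rewrite -?ca.
  have k_ne : k != a l by move: nk; rewrite l0 (ltnW lm).
  by exists (a l); [apply: a_in|]; lia.
split=> /= [|c ec kc].
  rewrite /erased Ak /=; apply/negP => /andP [/andP [l0]] /[swap] /eqP ka.
  rewrite leq_eqVlt => /orP [/eqP lm|lm]; first by apply: ne; rewrite ka lm.
  have [al near] := a_nearest (l := l) ltac:(lia).
  have [|k' Ak' /andP [? k'a]] := H (a l.+1) (a_in (l := l.+1) ltac:(lia)).
    by rewrite ka.
  by have := near _ Ak' k'a; lia.
have /andP [Ac _] := ec; have [k0 Ak0 /andP [? k0c]] := H c Ac kc.
by have [k' ek' ?] := erased_witness ec Ak0 k0c; exists k'; lia.
Qed.

End EraseChain.

(** * Selections in tables *)

(** Rows of the table as sets of natural numbers, like the marks of a path. *)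
Definition ones L (T : table L) (l k : nat) : bool :=
  [exists j : 'I_L, (val j == k) && is_one T (l, j)].

Lemma ones_ord L (T : table L) l (j : 'I_L) : ones T l j = is_one T (l, j).
Proof.
apply/existsP/idP => [[i /andP [/eqP/val_inj ->]] //|Tj].
by exists j; rewrite eqxx.
Qed.

Lemma onesP L (T : table L) (l k : nat) :
  reflect (exists2 j : 'I_L, k = j & is_one T (l, j)) (ones T l k).
Proof.
apply: (iffP existsP) => [[j /andP [/eqP/esym e Tj]]|[j e Tj]]; exists j => //.
by rewrite e eqxx.
Qed.

Definition natpos L (p : position L) : nat * nat := (p.1, val p.2).

Lemma natpos_inj L : injective (@natpos L).
Proof. by move=> [l j] [l' j'] [-> /val_inj ->]. Qed.

Definition first_row_count L (T : table L) : nat :=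
  #|[pred j : 'I_L | is_one T (1, j)]|.

(** What both procedures preserve and need: all but interlacing just says that
    the table is a finite set of 1's in the rows from 1 on. *)
Definition good_table L (T : table L) : Prop :=
  [/\ interlaced (ones T), forall k, ~~ ones T 0 k,
      forall l j, T l j = 0%R \/ T l j = 1%R
    & exists H, forall l k, ones T l k -> l <= H].

Lemma is_one_erase L (T : table L) s p :
  is_one (erase T s) p = is_one T p && (p \notin s.1 :: s.2).
Proof.
case: p => l j; rewrite /is_one /erase /=.
by case: ((l, j) \in _); rewrite ?andbF ?andbT.
Qed.

Lemma chain_columns L (T : table L) p qs :
    is_one T p -> path (nearest_left T) p qs -> (last p qs).1 = 1 ->
  exists a : nat -> nat,
  [/\ a p.1 = p.2, 0 < p.1,
      forall (l : nat) (j : 'I_L),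
        ((l, j) \in p :: qs) = (0 < l <= p.1) && (val j == a l),
      forall l, 0 < l <= p.1 -> ones T l (a l)
    & forall l, 0 < l < p.1 -> a l <= a l.+1
        /\ forall k, ones T l k -> k <= a l.+1 -> k <= a l].
Proof.
elim: qs p => [|q qs IH] p Tp /=.
  move=> _ p1; exists (fun _ => val p.2); rewrite p1; split=> //.
  - move=> l j; rewrite inE; case: p p1 {Tp} => _ i /= ->.
    by rewrite xpair_eqE (_ : (0 < l <= 1) = (l == 1)) //; lia.
  - move=> l l1; have -> : l = 1 by lia.
    by rewrite ones_ord -p1 -surjective_pairing.
move=> /andP [/and4P [/eqP pq Tq qp near]] /(IH q Tq) H /H {H IH}.
case=> a [aq q0 amem ain anear].
exists (fun l => if l == p.1 then val p.2 else a l); split.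
- by rewrite eqxx.
- by rewrite pq.
- move=> l j; rewrite inE amem; case: p pq {Tp qp near} => _ i /= ->.
  rewrite xpair_eqE; case: (eqVneq l q.1.+1) => [->|lq] /=.
    by rewrite ltnn /= orbF leqnn.
  by rewrite (_ : (0 < l <= q.1.+1) = (0 < l <= q.1)) //; lia.
- move=> l; case: (eqVneq l p.1) => [->|lp] l0; last by apply: ain; lia.
  by rewrite ones_ord -surjective_pairing.
move=> l l0; have -> : (l == p.1) = false by lia.
case: (eqVneq l.+1 p.1) => [lp|lp]; last by apply: anear; lia.
have -> : l = q.1 by lia.
rewrite aq; split=> // k /onesP [j -> Tj] jp.
by move/forallP/(_ j)/implyP: near; apply; rewrite Tj.
Qed.

Lemma erase_chain L (T : table L) s p qs :
    good_table T -> is_one T p -> path (nearest_left T) p qs -> (last p qs).1 = 1 ->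
    chain_end (ones T) (natpos p) -> s.1 :: s.2 =i p :: qs ->
  [/\ good_table (erase T s), first_row_count T = (first_row_count (erase T s)).+1
    & forall q, chain_end (ones (erase T s)) q <->
                chain_end (ones T) q /\ q <> natpos p].
Proof.
move=> [il T0 T01 [H TH]] Tp pth lst pend sE.
have [a [ap p0 amem ain anear]] := chain_columns Tp pth lst.
have eE l k : ones (erase T s) l k = erased (ones T) p.1 a l k.
  apply/onesP/andP => [[j ->]|[/onesP [j -> Tj] nj]].
    by rewrite is_one_erase sE amem ones_ord => /andP [].
  by exists j => //; rewrite is_one_erase sE amem Tj.
have pendE : chain_end (ones T) (p.1, a p.1) by rewrite ap.
split.
- split.
  + have := erased_interlaced T0 il ain anear pendE.
    move=> I l c l0; rewrite eE => /(I _ _ l0) [[k ek kc] I2].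
    split; first by exists k; rewrite ?eE.
    by move=> c'; rewrite eE => /I2 {}I2 /I2 [k' ek' ?]; exists k'; rewrite ?eE.
  + by move=> k; rewrite eE /erased negb_and T0.
  + by move=> l j; rewrite /erase; case: ifP; [left|].
  + by exists H => l k; rewrite eE => /andP [/TH].
- have /onesP [j aj Tj] := ain 1 p0.
  rewrite /first_row_count (cardD1 j) inE /= Tj add1n; congr _.+1; apply: eq_card => i.
  by rewrite !inE is_one_erase sE amem p0 /= aj andbC.
move=> q; rewrite (chain_end_ext _ eE) (erased_chain_end T0 il ain anear pendE).
by rewrite ap.
Qed.

(** All that has to be known about one repetition, whichever procedure it
    belongs to. *)
Definition removes_end L (step : table L -> selection L -> Prop)
    (pick : selection L -> position L) : Prop :=
  forall T s, good_table T -> step T s ->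
  [/\ good_table (erase T s), first_row_count T = (first_row_count (erase T s)).+1,
      chain_end (ones T) (natpos (pick s))
    & forall q, chain_end (ones (erase T s)) q <->
                chain_end (ones T) q /\ q <> natpos (pick s)].

(** A lowest 1 is an end for lack of a next row. *)
Lemma select_left_end L : removes_end (@select_left L) (@first_picked L).
Proof.
move=> T [p qs] gT [[Tp low] pth lst].
have pend : chain_end (ones T) (natpos p).
  split=> [|c /onesP [j _ /low]]; first by rewrite ones_ord -surjective_pairing.
  by rewrite ltnn.
by have [|? ? ?] := erase_chain (s := (p, qs)) gT Tp pth lst pend.
Qed.

(** If p is the rightmost position of its row, two positions of the next row
    weakly on its right would enclose a further one of its row.  So the picked
    one is the rightmost of its row, and the nearest one on its left is p. *)
Lemma right_path_nearest L (T : table L) p qs :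
    interlaced (ones T) -> 0 < p.1 -> is_one T p ->
    (forall k, ones T p.1 k -> k <= p.2) ->
    path (fun p q => [&& q.1 == p.1.+1, is_one T q & p.2 <= q.2]) p qs ->
  [/\ path (fun p q => nearest_left T q p) p qs, is_one T (last p qs)
    & forall k, ones T (last p qs).1 k -> k <= (last p qs).2].
Proof.
move=> il; elim: qs p => [|q qs IH] p p0 Tp pmax //=.
move=> /andP [/and3P [/eqP qp Tq pq] pth].
have qmax k : ones T q.1 k -> k <= q.2.
  rewrite qp => Tk; rewrite leqNgt; apply/negP => qk.
  have [_ /(_ q.2)] := il _ _ p0 Tk.
  rewrite -qp ones_ord -surjective_pairing => /(_ Tq qk) [a /pmax ap /andP [qa _]].
  by have := leq_ltn_trans pq qa; rewrite ltnNge ap.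
have [-> -> ?] := IH q ltac:(lia) Tq qmax pth.
split=> //; rewrite andbT /nearest_left qp eqxx Tp pq /=.
apply/forallP => j; apply/implyP => /andP [Tj _].
by apply: pmax; rewrite ones_ord.
Qed.

(** The selection read backwards is a chain followed from its end. *)
Lemma select_right_end L : removes_end (@select_right L) (@last_picked L).
Proof.
move=> T [p qs] gT [[/= p1 Tp pmax] [pth stop]].
rewrite /last_picked /= in stop *; have [il _ _ _] := gT.
have [|k /onesP [j -> Tj]|npth Tl lmax] := right_path_nearest il _ Tp _ pth.
- by rewrite p1.
- by apply: pmax; rewrite -p1.
have lend : chain_end (ones T) (natpos (last p qs)).
  split=> [|c /onesP [j -> Tj] /stop]; first by rewrite ones_ord -surjective_pairing.
  by rewrite Tj.
have revE : last (last p qs) (rev (belast p qs)) = p.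
  by case: (qs) => //= q r; rewrite rev_cons last_rcons.
have [|||? ? ?] := erase_chain (s := (p, qs)) (qs := rev (belast p qs)) gT Tl _ _ lend.
- by rewrite rev_path.
- by rewrite revE.
- by move=> q /=; rewrite -rev_rcons -lastI mem_rev.
by split.
Qed.

(** * Repeating a selection *)

Section Repetition.

Variables (L : nat) (step : table L -> selection L -> Prop).
Variable pick : selection L -> position L.
Hypothesis step_end : removes_end step pick.

Lemma repeated_ends T ss : good_table T -> repeated step T ss ->
  [/\ good_table (remaining T ss),
      first_row_count T = first_row_count (remaining T ss) + size ss,
      uniq [seq pick s | s <- ss]
    & forall q, chain_end (ones T) q <->
        q \in [seq natpos (pick s) | s <- ss]
        \/ chain_end (ones (remaining T ss)) q].
Proof.
elim: ss T => [|s ss IH] T gT /=.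
  by move=> _; split; rewrite ?addn0 // => q; split=> [|[]//]; right.
case=> /(step_end gT) [gT' -> pend ends] /(IH _ gT') [gR -> uniq_ss endsR].
split=> //; first by rewrite addnS.
  rewrite uniq_ss andbT; apply/negP => inss.
  have /endsR/ends [//] : natpos (pick s) \in [seq natpos (pick s) | s <- ss] \/
     chain_end (ones (remaining (erase T s) ss)) (natpos (pick s)).
  by left; rewrite (map_comp (@natpos L) pick) map_f.
move=> q; rewrite inE; case: (eqVneq q (natpos (pick s))) => [->|/eqP ne] /=.
  by split=> // _; left.
by rewrite -endsR ends; split=> [|[]].
Qed.

(** When row 1 is exhausted so are all other rows, since in an interlaced table
    each 1 has another one in the row above. *)
Lemma repeated_complete T ss :
    good_table T -> repeated step T ss -> size ss = first_row_count T ->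
  [/\ forall l j, remaining T ss l j = 0%R, uniq [seq pick s | s <- ss]
    & forall q, q \in [seq natpos (pick s) | s <- ss] <-> chain_end (ones T) q].
Proof.
move=> gT /(repeated_ends gT) [[il R0 R01 _] cnt uniq_ss ends] sz.
have r1 : first_row_count (remaining T ss) = 0 by lia.
have none l k : ~~ ones (remaining T ss) l k.
  elim: l k => [//|[|l] IH] k; apply/negP => Rk.
    have /onesP [j _ Rj] := Rk; move/card0_eq/(_ j): r1.
    by rewrite inE Rj.
  by have [[a Ra _] _] := il l.+1 k (ltn0Sn _) Rk; have := IH a; rewrite Ra.
split=> // [l j|q].
  case: (R01 l j) => // R1; have := none l j.
  by rewrite ones_ord /is_one R1 eqxx.
by rewrite ends; split=> [|[|[]]]; [left| |rewrite (negbTE (none _ _))].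
Qed.

End Repetition.

(** * Existence of selections *)

Lemma first_row_count_gt0 L (T : table L) :
  0 < first_row_count T -> exists j, is_one T (1, j).
Proof. by case/card_gt0P=> j; exists j. Qed.

(** The selection is prolonged greedily, which stops as the table has finitely
    many nonzero rows. *)
Lemma select_right_exists L (T : table L) :
  good_table T -> 0 < first_row_count T -> exists s, select_right T s.
Proof.
move=> [_ _ _ [H TH]] /first_row_count_gt0 [j0 Tj0].
case: (arg_maxnP (P := fun j => is_one T (1, j)) (fun j : 'I_L => val j) Tj0).
move=> j Tj jmax.
have extend n p : H - p.1 <= n -> exists qs,
    path (fun p q => [&& q.1 == p.1.+1, is_one T q & p.2 <= q.2]) p qs /\
    forall i : 'I_L, (last p qs).2 <= i -> ~~ is_one T ((last p qs).1.+1, i).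
  elim: n p => [|n IH] p Hp.
    exists [::]; split=> // i _; apply/negP; rewrite -ones_ord => /TH /=; lia.
  case: (pickP (fun i : 'I_L => is_one T (p.1.+1, i) && (p.2 <= i))) => [i|no].
    case/andP=> Ti pi; have [|qs [pth stop]] := IH (p.1.+1, i) _.
      by move: Ti; rewrite -ones_ord => /TH /=; lia.
    by exists ((p.1.+1, i) :: qs); rewrite /= eqxx Ti pi.
  exists [::]; split=> // i pi; have := no i.
  by rewrite /= in pi *; rewrite pi andbT => ->.
have [qs [pth stop]] := extend _ (1, j) (leqnn _).
by exists ((1, j), qs).
Qed.

Lemma lowest_one_exists L (T : table L) :
  good_table T -> 0 < first_row_count T -> exists p, lowest_one T p.
Proof.
move=> [_ _ _ [H TH]] /first_row_count_gt0 [j0 Tj0].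
have ex : exists l, [exists j, is_one T (l, j)] by exists 1; apply/existsP; exists j0.
have bd l : [exists j, is_one T (l, j)] -> l <= H.
  by case/existsP=> j; rewrite -ones_ord => /TH.
case: (ex_maxnP ex bd) => l /existsP [j Tj] lmax.
exists (l, j); split=> // -[l' j'] Tj'; apply: lmax.
by apply/existsP; exists j'.
Qed.

Lemma select_left_exists L (T : table L) p :
  good_table T -> lowest_one T p -> exists s, select_left T (p, s).
Proof.
move=> [il T0 _ _] [Tp low].
suff [qs [pth lst]] : exists qs, path (nearest_left T) p qs /\ (last p qs).1 = 1.
  by exists qs; split.
case: p Tp {low} => l; elim: l => [|[|l] IH] j Tj.
- by have := T0 j; rewrite ones_ord Tj.
- by exists [::].
have Tj' := Tj; rewrite -ones_ord in Tj'.
have [[a /onesP [i -> Ti] ij] _] := il l.+1 j (ltn0Sn _) Tj'.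
have Pi : is_one T (l.+1, i) && (i <= j) by rewrite Ti.
case: (arg_maxnP (P := fun i => is_one T (l.+1, i) && (i <= j))
  (fun j : 'I_L => val j) Pi) => k /andP [Tk kj] kmax.
have [qs [pth lst]] := IH k Tk.
exists ((l.+1, k) :: qs); split=> //=; rewrite pth andbT /nearest_left /= eqxx Tk kj.
by apply/forallP => i'; apply/implyP => /kmax.
Qed.

(** * The local energy distribution *)

Section Distribution.

Variables (L : nat) (b : L.-tuple elt).

Lemma local_energyE l (j : 'I_L) : local_energy b l j = loaded b l j.
Proof.
case: l => [|l] /=; first by rewrite loadedE min0n.
by rewrite /loaded (tnth_nth (0, 0)).
Qed.

Lemma distributionE l j : distribution b l j = (mark b l j : nat)%:Z%R.
Proof.
rewrite /distribution !local_energyE /mark.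
case: l => [|l] /=; first by rewrite ltnn; lia.
by have := loadedS b l j; lia.
Qed.

Lemma ones_distribution l k : ones (distribution b) l k = mark b l k.
Proof.
apply/onesP/idP => [[j ->]|mk].
  by rewrite /is_one distributionE /=; case: mark.
have kL : k < L by have := mark_lt_size mk; rewrite size_tuple.
by exists (Ordinal kL); rewrite // /is_one distributionE /= mk.
Qed.

Lemma good_table_distribution : good_table (distribution b).
Proof.
split.
- move=> l c l0; rewrite ones_distribution => /(mark_interlaced l0) [[a ma ac] H].
  split; first by exists a; rewrite ?ones_distribution.
  move=> c'; rewrite ones_distribution => /H{}H /H [a' ma' ?].
  by exists a'; rewrite ?ones_distribution.
- by move=> k; rewrite ones_distribution; apply/negP => /mark_row_gt0.
- by move=> l j; rewrite distributionE; case: mark; [right|left].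
exists (\sum_(x <- b) x.2) => l k; rewrite ones_distribution.
exact: mark_row_le.
Qed.

Lemma first_row_count_distribution :
  first_row_count (distribution b) = \sum_(j < L) local_energy b 1 j.
Proof.
rewrite /first_row_count -sum1_card big_mkcond; apply: eq_bigr => j _.
rewrite inE -ones_ord ones_distribution local_energyE /mark.
by have := loadedS b 0 j; rewrite /= [loaded b 0 j]loadedE min0n; case: ltnP; lia.
Qed.

Variable lam : L.-tuple nat.
Hypothesis b_lam : forall i : 'I_L, tnth b i \in crystal (tnth lam i).

Lemma weight_lam : map weight b = lam.
Proof.
apply: (@eq_from_nth _ 0); rewrite size_map !size_tuple // => i iL.
have := b_lam (Ordinal iL); rewrite (nth_map (0, 0)) ?size_tuple //.
by rewrite !(tnth_nth 0) (tnth_nth (0, 0)) inE => /eqP.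
Qed.

Lemma rigging_mark_rigging p : rigging lam b p = mark_rigging b (natpos p).
Proof.
case: p => m j; rewrite /rigging /mark_rigging /path_vacancy /= !sum_Posz local_energyE.
have jb : j <= size b by rewrite size_tuple ltnW.
have -> : \sum_(i < L | i < j) minn m (tnth lam i)
          = \sum_(x <- take j b) minn m (weight x).
  transitivity (\sum_(i < L | i < j) minn m (nth 0 lam i)).
    by apply: eq_bigr => i _; rewrite (tnth_nth 0).
  rewrite -(big_ord_widen L (fun i => minn m (nth 0 lam i)) (ltnW (ltn_ord j))).
  rewrite -(big_map weight xpredT (minn m)) map_take weight_lam.
  rewrite (big_nth 0) size_takel ?size_tuple 1?ltnW // big_mkord.
  by apply: eq_bigr => i _; rewrite nth_take.
have -> : \sum_(i < L | i <= j) local_energy b m i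
          = \sum_(k < size (take j b)) loaded (take j b) m k + loaded b m j.
  transitivity (\sum_(i < L | i < j.+1) loaded b m i).
    by apply: eq_bigr => i _; rewrite local_energyE.
  rewrite -(big_ord_widen L (fun i => loaded b m i) (ltn_ord j)) big_ord_recr /=.
  rewrite size_takel //; congr addn; apply: eq_bigr => i _.
  by rewrite loaded_take.
move: (\sum_(x <- _) _) (\sum_(k < _) _) (loaded _ _ _) => u v w; lia.
Qed.

Hypothesis lam_gt0 : forall i : 'I_L, 0 < tnth lam i.

Lemma is_phi_positions ps :
    uniq ps ->
    (forall q, q \in map (@natpos L) ps
               <-> chain_end (ones (distribution b)) q) ->
  forall rc, is_phi b rc <-> rc_equiv (rc_of_positions lam b ps) rc.
Proof.
move=> ups psP rc; rewrite (is_phi_rows (ps := map (@natpos L) ps)).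
- rewrite /rc_of_positions /rows_at weight_lam -map_comp.
  rewrite (_ : map _ ps = [seq (p.1, rigging lam b p) | p <- ps]) //.
  by apply: eq_map => p; rewrite /= rigging_mark_rigging.
- rewrite -(all_map weight) weight_lam; apply/allP => _ /tnthP [i ->].
  exact: lam_gt0.
- by rewrite map_inj_uniq //; apply: natpos_inj.
by move=> p; rewrite psP (chain_end_ext _ ones_distribution).
Qed.

End Distribution.

Lemma repeated_positions L (b : L.-tuple elt) step pick ss :
    @removes_end L step pick -> repeated step (distribution b) ss ->
    size ss = first_row_count (distribution b) ->
  [/\ forall l j, remaining (distribution b) ss l j = 0%R,
      uniq [seq pick s | s <- ss]
    & forall q, q \in map (@natpos L) [seq pick s | s <- ss] <->
        chain_end (ones (distribution b)) q].
Proof.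
move=> step_end rep /(repeated_complete step_end (good_table_distribution b) rep).
by case=> ? ? endsP; split=> // q; rewrite -map_comp.
Qed.

Theorem theorem2p2 (L : nat) (lam : L.-tuple nat) (b : L.-tuple elt)
    (lam_gt0 : forall i : 'I_L, 0 < tnth lam i)
    (b_lam : forall i : 'I_L, tnth b i \in crystal (tnth lam i)) :
  let N := \sum_(j < L) local_energy b 1 j in
  let T := distribution b in
  (* With the weakly right picks: none of the N repetitions can get stuck, and after them no 1 is
     left and the result is phi(b). *)
  [/\ forall ss, repeated (@select_right L) T ss -> size ss < N ->
        exists s, select_right (remaining T ss) s
    & forall ss, repeated (@select_right L) T ss -> size ss = N ->
        (forall l j, remaining T ss l j = 0%R)
        /\ forall rc, is_phi b rc <->
             rc_equiv (rc_of_positions lam b [seq last_picked s | s <- ss]) rc]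
  /\
  (* The same with the nearest weakly left picks, from any choice of a lowest 1. *)
  [/\ forall ss, repeated (@select_left L) T ss -> size ss < N ->
        (exists p, lowest_one (remaining T ss) p)
        /\ forall p, lowest_one (remaining T ss) p ->
             exists s, select_left (remaining T ss) (p, s)
    & forall ss, repeated (@select_left L) T ss -> size ss = N ->
        (forall l j, remaining T ss l j = 0%R)
        /\ forall rc, is_phi b rc <->
             rc_equiv (rc_of_positions lam b [seq first_picked s | s <- ss]) rc]
  /\
  (* Both procedures give the same positions up to a permutation. *)
  forall ss ss',
    repeated (@select_right L) T ss -> size ss = N ->
    repeated (@select_left L) T ss' -> size ss' = N ->
    perm_eq [seq last_picked s | s <- ss] [seq first_picked s | s <- ss'].
Proof.
move=> N T; have gT : good_table T := good_table_distribution b.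
have NE : N = first_row_count T by rewrite first_row_count_distribution.
have rightP := @select_right_end L; have leftP := @select_left_end L.
split; [split|split; [split|]].
- move=> ss /(repeated_ends rightP gT) [gR cnt _ _] lt_ss.
  by apply: select_right_exists => //; lia.
- move=> ss rep; rewrite NE => /(repeated_positions rightP rep) [zero u ends].
  by split=> //; apply: is_phi_positions.
- move=> ss /(repeated_ends leftP gT) [gR cnt _ _] lt_ss.
  split; first by apply: lowest_one_exists => //; lia.
  by move=> p; apply: select_left_exists.
- move=> ss rep; rewrite NE => /(repeated_positions leftP rep) [zero u ends].
  by split=> //; apply: is_phi_positions.
move=> ss ss' rep + rep'; rewrite NE.
move=> /(repeated_positions rightP rep) [_ u ends].
move=> /(repeated_positions leftP rep') [_ u' ends'].
apply: uniq_perm => // p; rewrite -!(mem_map (@natpos_inj L)).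
by apply/idP/idP => [/ends/ends'|/ends'/ends].
Qed.
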